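(* Let $K=\mathbf{C}$, let $\mathcal{N}\subset K^{n\times n}$ be the variety of nilpotent $n\times n$ matrices, and let $U\subset \mathrm{GL}_n(K)$ be the standard unipotent subgroup of upper-triangular matrices with all diagonal entries equal to $1$, acting on $\mathcal{N}$ by conjugation. Then the space $$\mathcal{H}_U:=\{H\in\mathcal{N}\mid H_{i,j}=0 \text{ for } i\le j;\ H_{i+1,i}\neq 0 \text{ for all } i\in\{1,\dots,n-1\}\}$$ is a generic normal form for the $U$-action on $\mathcal{N}$.
   Context: Let $G$ be an algebraic group acting on an affine variety $X$. A subset $X_0\subseteq X$ is called a generic normal form if (1) $G.X_0\subseteq X$ is open, and (2) $G.x\ne G.x'$ for all $x,x'\in X_0$ with $x\neq x'$. Openness is in the Zariski topology. *)

(* Defs.v *)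
From HB Require Import structures.
From mathcomp Require Import all_boot all_order all_algebra.
From mathcomp Require Import boolp classical_sets reals complex.
From mathcomp Require Import mpoly.

Set Implicit Arguments.
Unset Strict Implicit.
Unset Printing Implicit Defensive.

Import GRing.Theory.
Local Open Scope ring_scope.
Local Open Scope classical_set_scope.

Section AffineGeometry.
Variable K : closedFieldType.

(* The affine space of m x n matrices has coordinate ring {mpoly K[m * n]};
   mxvec numbers the entries. *)
Definition zero_locus m n (S : set {mpoly K[m * n]}) : set 'M[K]_(m, n) :=
  [set A | forall p, S p -> p.@[mxvec A 0] = 0].

Definition zariski_closed m n (Z : set 'M[K]_(m, n)) : Prop :=
  exists S : set {mpoly K[m * n]}, Z = zero_locus S.

Definition zariski_open_in m n (X W : set 'M[K]_(m, n)) : Prop :=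
  exists2 Z, zariski_closed Z & W = X `\` Z.

(* As K is algebraically closed, varieties are identified with their sets of
   K-points; they are not required to be irreducible. *)
Record affine_variety m n := AffineVariety {
  points : set 'M[K]_(m, n);
  points_closed : zariski_closed points
}.

Record algebraic_group d := AlgebraicGroup {
  elements : set 'M[K]_d;
  elements_closed : exists2 Z : set 'M[K]_d,
    zariski_closed Z & elements = Z `&` [set g | g \in unitmx];
  elements1 : elements 1%:M;
  elementsM : forall g h, elements g -> elements h -> elements (g *m h);
  elementsV : forall g, elements g -> elements (invmx g)
}.

(* (det g)^-1 is a coordinate of its own because the coordinate ring of GL_d is
   the localization of {mpoly K[d * d]} at \det. *)
Definition pair_coord d m n (g : 'M[K]_d) (x : 'M[K]_(m, n)) :
    'rV[K]_(d * d + 1 + m * n) :=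
  row_mx (row_mx (mxvec g) (\det g)^-1%:M) (mxvec x).

(* The action map is only meaningful on G x X, where it has to be a morphism of
   varieties. *)
Record algebraic_action d m n
    (G : algebraic_group d) (X : affine_variety m n) := AlgebraicAction {
  act :> 'M[K]_d -> 'M[K]_(m, n) -> 'M[K]_(m, n);
  act_in : forall g x, elements G g -> points X x -> points X (act g x);
  act1 : forall x, points X x -> act 1%:M x = x;
  actM : forall g h x, elements G g -> elements G h -> points X x ->
    act (g *m h) x = act g (act h x);
  act_regular : forall i j, exists p : {mpoly K[d * d + 1 + m * n]},
    forall g x, elements G g -> points X x -> act g x i j = p.@[pair_coord g x 0]
}.

Section GenericNormalForm.
Variables (d m n : nat) (G : algebraic_group d) (X : affine_variety m n).
Variable a : algebraic_action G X.

Definition orbit (x : 'M[K]_(m, n)) : set 'M[K]_(m, n) :=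
  [set a g x | g in elements G].

Definition saturation (X0 : set 'M[K]_(m, n)) : set 'M[K]_(m, n) :=
  \bigcup_(x in X0) orbit x.

Definition generic_normal_form (X0 : set 'M[K]_(m, n)) : Prop :=
  [/\ X0 `<=` points X,
      zariski_open_in (points X) (saturation X0) &
      forall x x', X0 x -> X0 x' -> x <> x' -> orbit x <> orbit x'].

End GenericNormalForm.

Section PolynomialFunctions.
Variables (T : Type) (N : nat) (c : T -> 'I_N -> K).

Definition polyfun (f : T -> K) : Prop :=
  exists p : {mpoly K[N]}, forall t, f t = p.@[c t].

Lemma polyfun_ext f g : f =1 g -> polyfun f -> polyfun g.
Proof. by move=> fg [p pE]; exists p => t; rewrite -fg. Qed.

Lemma polyfun_coord i : polyfun (fun t => c t i).
Proof. by exists 'X_i => t; rewrite mevalXU. Qed.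

Lemma polyfun_cst b : polyfun (fun=> b).
Proof. by exists b%:MP => t; rewrite mevalC. Qed.

Lemma polyfunD f g : polyfun f -> polyfun g -> polyfun (fun t => f t + g t).
Proof.
by move=> [p pE] [q qE]; exists (p + q) => t; rewrite mevalD -pE -qE.
Qed.

Lemma polyfunM f g : polyfun f -> polyfun g -> polyfun (fun t => f t * g t).
Proof.
by move=> [p pE] [q qE]; exists (p * q) => t; rewrite mevalM -pE -qE.
Qed.

Lemma polyfun_sum (I : finType) (f : I -> T -> K) :
  (forall i, polyfun (f i)) -> polyfun (fun t => \sum_i f i t).
Proof.
move=> fP; elim: (index_enum I) => [|i s IH].
  by apply: polyfun_ext (polyfun_cst 0) => t; rewrite big_nil.
by apply: polyfun_ext (polyfunD (fP i) IH) => t; rewrite big_cons.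
Qed.

Lemma polyfun_prod (I : finType) (f : I -> T -> K) :
  (forall i, polyfun (f i)) -> polyfun (fun t => \prod_i f i t).
Proof.
move=> fP; elim: (index_enum I) => [|i s IH].
  by apply: polyfun_ext (polyfun_cst 1) => t; rewrite big_nil.
by apply: polyfun_ext (polyfunM (fP i) IH) => t; rewrite big_cons.
Qed.

Definition polymap m n (F : T -> 'M[K]_(m, n)) : Prop :=
  forall i j, polyfun (fun t => F t i j).

Lemma polymap_mul m n p (F : T -> 'M[K]_(m, n)) (H : T -> 'M[K]_(n, p)) :
  polymap F -> polymap H -> polymap (fun t => F t *m H t).
Proof.
move=> FP HP i j; apply: (@polyfun_ext (fun t => \sum_k F t i k * H t k j)).
  by move=> t; rewrite mxE.
by apply: polyfun_sum => k; apply: polyfunM.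
Qed.

Lemma polymap_exp n (F : T -> 'M[K]_n) k :
  polymap F -> polymap (fun t => F t ^+ k).
Proof.
move=> FP; elim: k => [|k IH] i j.
  by apply: polyfun_ext (polyfun_cst ((1 : 'M[K]_n) i j)) => t; rewrite expr0.
by apply: polyfun_ext (polymap_mul FP IH i j) => t; rewrite exprS.
Qed.

Lemma polyfun_det n (F : T -> 'M[K]_n) :
  polymap F -> polyfun (fun t => \det (F t)).
Proof.
move=> FP; apply: polyfun_sum => s; apply: polyfunM; first exact: polyfun_cst.
by apply: polyfun_prod => i; apply: FP.
Qed.

Lemma polymap_adj n (F : T -> 'M[K]_n) :
  polymap F -> polymap (fun t => \adj (F t)).
Proof.
move=> FP i j.
apply: (@polyfun_ext (fun t => (-1) ^+ (j + i) * \det (row' j (col' i (F t))))).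
  by move=> t; rewrite mxE.
apply: polyfunM; first exact: polyfun_cst.
apply: polyfun_det => k l; apply: polyfun_ext (FP (lift j k) (lift i l)) => t.
by rewrite !mxE.
Qed.

End PolynomialFunctions.

Lemma polymap_mxvec m n :
  polymap (fun A : 'M[K]_(m, n) => mxvec A 0) (fun A => A).
Proof.
move=> i j; apply: polyfun_ext (polyfun_coord _ (mxvec_index i j)) => A.
by rewrite mxvecE.
Qed.

Lemma zariski_closed_polyfun m n (I : Type) (f : I -> 'M[K]_(m, n) -> K) :
  (forall i, polyfun (fun A : 'M[K]_(m, n) => mxvec A 0) (f i)) ->
  zariski_closed [set A | forall i, f i A = 0].
Proof.
move=> /choice[p pE]; exists (range p); rewrite predeqE => A; split=> /= fA.
  by move=> _ [i _ <-]; rewrite -pE.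
by move=> i; rewrite pE; apply: fA; exists i.
Qed.

End AffineGeometry.

Section NilpotentVariety.
Variables (K : closedFieldType) (n : nat).

Definition nilpotent_mx (A : 'M[K]_n) : Prop := exists k : nat, A ^+ k = 0.

Definition nilpotent_matrices : set 'M[K]_n := [set A | nilpotent_mx A].

Definition unitriangular_matrices : set 'M[K]_n :=
  [set g | (forall i j : 'I_n, (j < i)%N -> g i j = 0) /\
           (forall i : 'I_n, g i i = 1)].

Definition conjugate_mx (g A : 'M[K]_n) : 'M[K]_n := g *m A *m invmx g.

Lemma nilpotent_mxP (A : 'M[K]_n) : nilpotent_mx A <-> A ^+ n = 0.
Proof.
split=> [[k]|An]; last by exists n.
case: n A => [|n'] A Ak; first by rewrite [LHS]flatmx0 [RHS]flatmx0.
have: mxminpoly A %| 'X^k by rewrite mxminpoly_min// rmorphXn/= horner_mx_X.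
rewrite -['X]subr0 -(polyC0 K) => /dvdp_exp_XsubCP[d [_]].
rewrite polyC0 subr0 => eqpX.
have led : (d <= n'.+1)%N.
  have := dvdp_leq (monic_neq0 (char_poly_monic A)) (mxminpoly_dvd_char A).
  by rewrite (eqp_size eqpX) size_char_poly size_polyXn.
have : mxminpoly A %| 'X^d by rewrite (eqp_dvdl _ eqpX) dvdpp.
move/mxminpoly_minP; rewrite rmorphXn/= horner_mx_X => Ad.
have -> : A ^+ n'.+1 = A ^+ (n'.+1 - d) * A ^+ d by rewrite -exprD subnK.
by rewrite Ad mulr0.
Qed.

Lemma nilpotent_matrices_closed : zariski_closed nilpotent_matrices.
Proof.
have := @zariski_closed_polyfun K n n ('I_n * 'I_n)
  (fun ij A => (A ^+ n) ij.1 ij.2)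
  (fun ij => polymap_exp n (@polymap_mxvec K n n) ij.1 ij.2).
congr zariski_closed; rewrite predeqE => A; split=> /=.
  by move=> A0; apply/nilpotent_mxP/matrixP => i j; rewrite (A0 (i, j)) mxE.
by move=> /nilpotent_mxP-> [i j]; rewrite mxE.
Qed.

Definition nilpotent_variety : affine_variety K n n :=
  AffineVariety nilpotent_matrices_closed.

Lemma unitriangular_det (g : 'M[K]_n) : unitriangular_matrices g -> \det g = 1.
Proof.
move=> [gU g1]; rewrite -det_tr det_trig.
  by rewrite big1// => i _; rewrite mxE.
by apply/is_trig_mxP => i j ij; rewrite mxE gU.
Qed.

Lemma unitriangular_unit (g : 'M[K]_n) :
  unitriangular_matrices g -> g \in unitmx.
Proof. by move=> /unitriangular_det gd; rewrite unitmxE gd unitr1. Qed.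

Lemma unitriangular_closed : exists2 Z : set 'M[K]_n, zariski_closed Z &
  unitriangular_matrices = Z `&` [set g | g \in unitmx].
Proof.
exists unitriangular_matrices; last first.
  by rewrite predeqE => g; split=> [gU|[]//]; split=> //;
    exact: unitriangular_unit.
pose f (ij : 'I_n * 'I_n) (A : 'M[K]_n) :=
  (ij.2 <= ij.1)%N%:R * (A ij.1 ij.2 + - (ij.1 == ij.2)%:R).
have : zariski_closed [set A | forall ij, f ij A = 0].
  apply: zariski_closed_polyfun => ij; apply: polyfunM.
    exact: polyfun_cst.
  by apply: polyfunD; [exact: polymap_mxvec|exact: polyfun_cst].
congr zariski_closed; rewrite predeqE => A; split=> /= [fA|[A0 A1] [i j]].
  split=> [i j ji|i]; last first.
    by have := fA (i, i); rewrite /f/= leqnn eqxx mul1r => /eqP;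
      rewrite subr_eq0 => /eqP.
  have := fA (i, j); rewrite /f/= (ltnW ji) -val_eqE/= gtn_eqF//.
  by rewrite mul1r subr0.
rewrite /f/=; case: ltngtP => [ji|ij|/val_inj->].
- by rewrite A0// -val_eqE/= gtn_eqF// subr0 mulr0.
- by rewrite mul0r.
- by rewrite A1 eqxx subrr mulr0.
Qed.

Lemma unitriangular1 : unitriangular_matrices 1%:M.
Proof.
split=> [i j ji|i]; last by rewrite mxE eqxx.
by rewrite mxE -val_eqE/= gtn_eqF.
Qed.

Lemma unitriangularM g h : unitriangular_matrices g ->
  unitriangular_matrices h -> unitriangular_matrices (g *m h).
Proof.
move=> [g0 g1] [h0 h1]; split=> [i j ji|i]; rewrite mxE.
  rewrite big1// => k _; case: (ltnP k i) => [ki|ik]; first by rewrite g0 ?mul0r.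
  by rewrite h0 ?mulr0// (leq_trans ji).
rewrite (bigD1 i)//= g1 h1 mulr1 big1 ?addr0// => k ki.
case: (ltngtP k i) => [lt|lt|/val_inj/eqP]; last by rewrite (negPf ki).
  by rewrite g0 ?mul0r.
by rewrite h0 ?mulr0.
Qed.

Lemma unitriangularV g : unitriangular_matrices g ->
  unitriangular_matrices (invmx g).
Proof.
move=> gU; have gu := unitriangular_unit gU; have [g0 g1] := gU.
set h := invmx g; have gh : g *m h = 1%:M by rewrite mulmxV.
have col (k : nat) : forall i j : 'I_n, (n - i <= k)%N -> (j <= i)%N ->
    h i j = (i == j)%:R.
  elim: k => [|k IH] i j ik ji.
    by have := ltn_ord i; rewrite -subn_gt0; move: ik; rewrite leqn0 => /eqP->.
  move/matrixP/(_ i j): gh; rewrite !mxE (bigD1 i)//= g1 mul1r.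
  rewrite big1 ?addr0// => l li.
  case: (ltngtP l i) => [lt|lt|/val_inj/eqP]; last by rewrite (negPf li).
    by rewrite g0 ?mul0r.
  rewrite IH ?(leq_trans ji (ltnW lt))//.
    by rewrite -val_eqE/= gtn_eqF ?mulr0// (leq_ltn_trans ji).
  by rewrite -ltnS (leq_trans _ ik)// ltn_sub2l// ltn_ord.
split=> [i j ji|i]; last by rewrite (col n)// ?leq_subr// eqxx.
by rewrite (col n) ?leq_subr 1?ltnW// -val_eqE/= gtn_eqF.
Qed.

Definition unitriangular_group : algebraic_group K n :=
  AlgebraicGroup unitriangular_closed unitriangular1 unitriangularM
    unitriangularV.

Lemma conjugate_nilpotent g A : elements unitriangular_group g ->
  points nilpotent_variety A -> points nilpotent_variety (conjugate_mx g A).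
Proof.
move=> /unitriangular_unit gu [k Ak]; exists k.
have -> : conjugate_mx g A ^+ k = g *m A ^+ k *m invmx g.
  elim: k {Ak} => [|k IH]; first by rewrite !expr0 mulmx1 mulmxV.
  rewrite !exprS IH /conjugate_mx -!mulmxE !mulmxA; congr (_ *m _ *m _).
  by rewrite mulmxKV.
by rewrite Ak mulmx0 mul0mx.
Qed.

Lemma conjugate1 A : points nilpotent_variety A -> conjugate_mx 1%:M A = A.
Proof. by move=> _; rewrite /conjugate_mx invmx1 mulmx1 mul1mx. Qed.

Lemma conjugateM g h A : elements unitriangular_group g -> elements unitriangular_group h ->
  points nilpotent_variety A ->
  conjugate_mx (g *m h) A = conjugate_mx g (conjugate_mx h A).
Proof.
move=> /unitriangular_unit gu /unitriangular_unit hu _.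
have ghu : g *m h \in unitmx by rewrite unitmx_mul gu.
have -> : conjugate_mx (g *m h) A = g *m (h *m A) *m invmx (g *m h).
  by rewrite /conjugate_mx !mulmxA.
have -> : invmx (g *m h) = invmx h *m invmx g.
  rewrite -[RHS](mulmxK ghu) -[_ *m _ *m (g *m h)]mulmxA [invmx g *m _]mulmxA.
  by rewrite mulVmx// mul1mx mulVmx// mul1mx.
by rewrite /conjugate_mx !mulmxA.
Qed.

Lemma conjugate_regular (i j : 'I_n) :
  exists p : {mpoly K[n * n + 1 + n * n]}, forall g A,
    elements unitriangular_group g -> points nilpotent_variety A ->
    conjugate_mx g A i j = p.@[pair_coord g A 0].
Proof.
pose c (gA : 'M[K]_n * 'M[K]_n) : 'I__ -> K := pair_coord gA.1 gA.2 0.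
have gP : polymap c (fun gA => gA.1).
  move=> k l; pose e := lshift (n * n) (lshift 1 (mxvec_index k l)).
  apply: polyfun_ext (polyfun_coord c e) => -[g A].
  by rewrite /c /e /pair_coord/= !row_mxEl mxvecE.
have AP : polymap c (fun gA => gA.2).
  move=> k l; pose e := rshift (n * n + 1) (mxvec_index k l).
  apply: polyfun_ext (polyfun_coord c e) => -[g A].
  by rewrite /c /e /pair_coord/= row_mxEr mxvecE.
have dP : polyfun c (fun gA => (\det gA.1)^-1).
  pose e := lshift (n * n) (rshift (n * n) (ord0 : 'I_1)).
  apply: polyfun_ext (polyfun_coord c e) => -[g A].
  by rewrite /c /e /pair_coord/= row_mxEl row_mxEr mxE eqxx.
have [p pE] := polyfunM dP (polymap_mul (polymap_mul gP AP) (polymap_adj gP) i j).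
exists p => g A gU _; rewrite -(pE (g, A))/=.
rewrite /conjugate_mx /invmx (unitriangular_unit gU).
by rewrite -scalemxAr [LHS]mxE.
Qed.

Definition conjugation_action :
    algebraic_action unitriangular_group nilpotent_variety :=
  AlgebraicAction conjugate_nilpotent conjugate1 conjugateM conjugate_regular.

Definition H_U : set 'M[K]_n :=
  [set H | [/\ nilpotent_mx H,
               (forall i j : 'I_n, (i <= j)%N -> H i j = 0) &
               (forall i j : 'I_n, i = j.+1 :> nat -> H i j != 0)]].

End NilpotentVariety.

Arguments H_U : clear implicits.

(* Main.v *)
Require Import Defs.
From mathcomp Require Import all_boot all_order all_algebra.
From mathcomp Require Import boolp classical_sets reals complex.
Import GRing.Theory.
Local Open Scope ring_scope.

(** Let [e] be the first basis vector and, for a matrix [A], let [M(A)] be the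
    Krylov matrix with columns [e, A e, ..., A^(n-1) e].  A unitriangular [g]
    fixes [e], so [M(g A g^-1) = g M(A)] ([krylov_mx_conjugate]): conjugation by
    [U] becomes left multiplication by [U], where a normal form is given by the
    factorization of a matrix as (upper unitriangular) * (lower triangular).

    For nilpotent [H], membership in [H_U] means exactly that [M(H)] is lower
    triangular and invertible ([H_U_krylov], [krylov_H_U]).  Hence a nilpotent
    [A] is [U]-conjugate to an element of [H_U] if and only if [M(A)] factors as
    [g L] with [g] unitriangular and [L] invertible lower triangular.  Such a
    factorization exists precisely when no trailing principal minor of [M(A)]
    vanishes ([UL_trailing_minors], [trailing_minors_UL]), and these minors are
    polynomials in the entries of [A]; so the saturation of [H_U] is open in the
    nilpotent variety.

    If [H] and [g H g^-1] both lie in [H_U], then [g] carries one invertible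
    lower triangular matrix to another, so [g] is lower triangular as well as
    unitriangular, that is [g = 1]. *)

(** * Right multiplication by a lower triangular matrix *)

Section TriangularProducts.
Context {K : fieldType}.

Lemma trig_mul_lead {m n} {A : 'M[K]_(m, n)} {L : 'M[K]_n} {i} {j : 'I_n} :
  is_trig_mx L -> (forall k : 'I_n, (j < k)%N -> A i k = 0) ->
  (A *m L) i j = A i j * L j j.
Proof.
move=> /is_trig_mxP Ltrig A0; rewrite mxE (bigD1 j)//= big1 ?addr0// => k kj.
case: (ltngtP k j) => [lt|lt|/val_inj/eqP]; last by rewrite (negPf kj).
  by rewrite Ltrig ?mulr0.
by rewrite A0 ?mul0r.
Qed.

Lemma unit_trig_diag {n} {L : 'M[K]_n} (j : 'I_n) :
  is_trig_mx L -> L \in unitmx -> L j j != 0.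
Proof.
by move=> Ltrig; rewrite unitmxE unitfE det_trig// => /prodf_neq0; apply.
Qed.

(** As [A = (A L) L^-1], this says that right division by [L] keeps the rows
    supported on the columns before [p]; the entries of row [i] are found from
    the last column backwards. *)
Lemma trig_mul_row0 {m n} {A : 'M[K]_(m, n)} {L : 'M[K]_n} {i} {p : nat} :
  is_trig_mx L -> L \in unitmx ->
  (forall j : 'I_n, (p <= j)%N -> (A *m L) i j = 0) ->
  forall j : 'I_n, (p <= j)%N -> A i j = 0.
Proof.
move=> Ltrig Lu AL0 j; have [k] := ubnP (n - j); elim: k j => // k IH j jk pj.
have := AL0 j pj; rewrite (trig_mul_lead Ltrig) => [|l jl]; last first.
  apply: IH; last exact: leq_trans pj (ltnW jl).
  by rewrite -ltnS (leq_trans _ jk)// ltnS ltn_sub2l// ltn_ord.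
by move/eqP; rewrite mulf_eq0 (negPf (unit_trig_diag j Ltrig Lu)) orbF => /eqP.
Qed.

(** The product of all trailing principal minors, as a single polynomial whose
    recursion peels off the same block as the factorization below. *)
Fixpoint trailing_minors n : 'M[K]_n -> K :=
  match n with
  | 0 => fun=> 1
  | n'.+1 => fun M => \det M * trailing_minors n' (@drsubmx K 1 n' 1 n' M)
  end.

End TriangularProducts.

(** * Factorization into upper unitriangular times lower triangular *)

Section ULFactorization.
Context {K : closedFieldType}.

Lemma block_unitriangular n (u : 'rV[K]_n) (g : 'M[K]_n) :
  unitriangular_matrices g ->
  @unitriangular_matrices K (1 + n) (block_mx 1%:M u 0 g).
Proof.
move=> [g0 g1]; split=> [i j|i].
  case: (split_ordP i) => i' ->; case: (split_ordP j) => j' -> /=.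
  - by rewrite !ord1.
  - by rewrite ord1.
  - by rewrite block_mxEdl mxE.
  - by rewrite block_mxEdr ltn_add2l; apply: g0.
by case: (split_ordP i) => i' ->;
  rewrite ?block_mxEul ?block_mxEdr ?ord1 ?mxE ?g1.
Qed.

Lemma drsubmx_unitriangular n (g : 'M[K]_(1 + n)) :
  unitriangular_matrices g ->
  dlsubmx g = 0 /\ unitriangular_matrices (drsubmx g).
Proof.
move=> [g0 g1]; split; first by apply/matrixP => i j; rewrite !mxE g0//= ord1.
split=> [i j ij|i]; rewrite !mxE ?g1// g0//=.
Qed.

Lemma drsubmx_mul m n (A B : 'M[K]_(m + n)) :
  dlsubmx A = 0 -> drsubmx (A *m B) = drsubmx A *m drsubmx B.
Proof.
move=> A0; rewrite -[in LHS](submxK A) -[in LHS](submxK B).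
by rewrite mulmx_block block_mxKdr A0 mul0mx add0r.
Qed.

Lemma UL_trailing_minors n (g L : 'M[K]_n) : unitriangular_matrices g ->
  is_trig_mx L -> L \in unitmx -> trailing_minors n (g *m L) != 0.
Proof.
elim: n g L => [|n IH] g L gU Ltrig Lu /=; first exact: oner_neq0.
have := Lu; rewrite unitmxE unitfE => Ldet.
rewrite mulf_neq0 ?det_mulmx ?(unitriangular_det gU) ?mul1r//.
have [g0 gU'] := @drsubmx_unitriangular n g gU.
have -> : @drsubmx K 1 n 1 n (g *m L) =
    @drsubmx K 1 n 1 n g *m @drsubmx K 1 n 1 n L by exact: drsubmx_mul.
have Ltrig' : is_trig_mx (@drsubmx K 1 n 1 n L).
  by apply/is_trig_mxP => i j ij; rewrite !mxE (is_trig_mxP Ltrig).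
apply: IH => //; rewrite unitmxE unitfE det_trig//; apply/prodf_neq0 => i _.
by rewrite !mxE (unit_trig_diag _ Ltrig Lu).
Qed.

(** With [M] split into blocks [a b / c D] and [D = g L], the factors of [M] are
    forced: [(1 u / 0 g) (s 0 / c' L)] equals [M] for [u = b L^-1],
    [c' = g^-1 c] and [s = a - u c'].  The determinant of [M] being nonzero
    makes the pivot [s] nonzero. *)
Lemma trailing_minors_UL n (M : 'M[K]_n) : trailing_minors n M != 0 ->
  exists g L, [/\ unitriangular_matrices g, is_trig_mx L, L \in unitmx &
                  M = g *m L].
Proof.
elim: n M => [|n IH] M /=.
  move=> _; exists 1%:M, 1%:M; split; rewrite ?unitmx1 ?scalar_mx_is_trig//.
    exact: unitriangular1.
  by rewrite [LHS]flatmx0 [RHS]flatmx0.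
rewrite mulf_eq0 negb_or => /andP[Mdet /IH[g [L [gU Ltrig Lu DE]]]].
have gu := unitriangular_unit gU.
pose u := @ursubmx K 1 n 1 n M *m invmx L.
pose c := invmx g *m @dlsubmx K 1 n 1 n M.
pose s := @ulsubmx K 1 n 1 n M - u *m c.
pose g' : 'M[K]_(1 + n) := block_mx 1%:M u 0 g.
pose L' : 'M[K]_(1 + n) := block_mx s 0 c L.
have ME : (M : 'M_(1 + n)) = g' *m L'.
  rewrite /g' /L' mulmx_block !mul1mx !mul0mx !add0r -DE subrK.
  by rewrite mulmxKV// mulKVmx// submxK.
have gU' : unitriangular_matrices g' by apply: block_unitriangular.
have Ltrig' : is_trig_mx L'.
  by rewrite /L' is_trig_block_mx// eqxx Ltrig mx11_is_trig.
exists g', L'; split=> //.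
by rewrite unitmxE unitfE -[\det _]mul1r -(unitriangular_det gU') -det_mulmx -ME.
Qed.

Lemma polyfun_trailing_minors (T : Type) (N : nat) (c : T -> 'I_N -> K) n
    (F : T -> 'M[K]_n) :
  polymap c F -> polyfun c (fun t => trailing_minors n (F t)).
Proof.
elim: n F => [|n IH] F FP; first exact: polyfun_cst.
apply: polyfunM; first exact: polyfun_det.
apply: IH => i j; apply: polyfun_ext (FP (rshift 1 i) (rshift 1 j)) => t.
by rewrite !mxE.
Qed.

End ULFactorization.

(** * The Krylov matrix of the first basis vector *)

Section Krylov.
Context {K : closedFieldType}.

(** Written with a comparison in [nat] so that it makes sense for [n = 0] too. *)
Definition first_vec n : 'cV[K]_n := \col_i (i == 0 :> nat)%:R.

Definition krylov_mx {n} (A : 'M[K]_n) : 'M[K]_n :=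
  \matrix_(i, j) (A ^+ j *m first_vec n) i 0.

Lemma unitriangular_first_vec n (g : 'M[K]_n) :
  unitriangular_matrices g -> g *m first_vec n = first_vec n.
Proof.
case: n g => [|n] g [g0 g1]; first by rewrite [LHS]flatmx0 [RHS]flatmx0.
apply/matrixP => i j; rewrite !mxE (bigD1 ord0)//= mxE eqxx mulr1.
rewrite big1 => [|k k0]; last first.
  by rewrite mxE -val_eqE in k0 *; rewrite (negPf k0) mulr0.
rewrite addr0; have [i0|i0] := posnP i.
  by have -> : i = ord0 by [exact: val_inj]; rewrite g1.
by rewrite g0// gtn_eqF.
Qed.

Lemma krylov_mx_conjugate n (g A : 'M[K]_n) : unitriangular_matrices g ->
  krylov_mx (conjugate_mx g A) = g *m krylov_mx A.
Proof.
move=> gU; have gu := unitriangular_unit gU.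
have E k : conjugate_mx g A ^+ k *m first_vec n = g *m (A ^+ k *m first_vec n).
  elim: k => [|k IH]; first by rewrite !expr0 !mul1mx unitriangular_first_vec.
  rewrite !exprS -!mulmxE -[in LHS]mulmxA IH /conjugate_mx !mulmxA.
  by rewrite mulmxKV.
apply/matrixP => i j; rewrite mxE E !mxE.
by apply: eq_bigr => k _; rewrite [in RHS]mxE.
Qed.

Lemma mul_krylov_mx n (A : 'M[K]_n) i j :
  (A *m krylov_mx A) i j = (A ^+ j.+1 *m first_vec n) i 0.
Proof.
rewrite exprS -mulmxE -mulmxA !mxE.
by apply: eq_bigr => k _; rewrite [in LHS]mxE.
Qed.

Lemma H_U_krylov {n} {H : 'M[K]_n} : H_U K n H ->
  is_trig_mx (krylov_mx H) /\ krylov_mx H \in unitmx.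
Proof.
move=> [_ H0 H1].
(* [H ^+ k] shifts the support of [first_vec] down by [k]. *)
have E k : (forall i : 'I_n, (i < k)%N -> (H ^+ k *m first_vec n) i 0 = 0) /\
    (forall i : 'I_n, i = k :> nat -> (H ^+ k *m first_vec n) i 0 != 0).
  elim: k => [|k [IH0 IH1]].
    split=> // i i0; rewrite expr0 mul1mx mxE i0 eqxx; exact: oner_neq0.
  rewrite exprS -mulmxE -mulmxA; split=> i ik; rewrite mxE.
    apply: big1 => l _; have [il|li] := leqP i l; first by rewrite H0 ?mul0r.
    by rewrite IH0 ?mulr0// (leq_trans li).
  have kn : (k < n)%N by rewrite ltnW// -ik.
  rewrite (bigD1 (Ordinal kn))//= big1 ?addr0 => [|l lk].
    by rewrite mulf_neq0 ?H1 ?IH1.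
  case: (ltngtP l k) => [lt|lt|lE].
  - by rewrite IH0 ?mulr0.
  - by rewrite H0 ?mul0r// ik.
  - by rewrite -val_eqE/= lE eqxx in lk.
have Mtrig : is_trig_mx (krylov_mx H).
  by apply/is_trig_mxP => i j ij; rewrite mxE (E j).1.
split=> //; rewrite unitmxE unitfE det_trig//; apply/prodf_neq0 => i _.
by rewrite mxE (E i).2.
Qed.

(** Since [H^n = 0], the matrix [H M(H)] is [M(H)] with its columns shifted one
    place to the left, so it is strictly lower triangular with nonzero entries
    just below the diagonal; dividing by [M(H)] preserves this shape. *)
Lemma krylov_H_U {n} {H : 'M[K]_n} : nilpotent_mx H ->
  is_trig_mx (krylov_mx H) -> krylov_mx H \in unitmx -> H_U K n H.
Proof.
move=> Hnil Mtrig Mu.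
have H0 (i j : 'I_n) : (i <= j)%N -> H i j = 0.
  apply: (trig_mul_row0 (p := i) Mtrig Mu) => {}j ij; rewrite mul_krylov_mx.
  have [jn|nj] := ltnP j.+1 n; last first.
    have -> : j.+1 = n by apply/eqP; rewrite eqn_leq nj ltn_ord.
    by rewrite (nilpotent_mxP H).1// mul0mx mxE.
  by have := is_trig_mxP Mtrig i (Ordinal jn) ij; rewrite mxE.
split=> // i j ij.
have E : (H *m krylov_mx H) i j = H i j * krylov_mx H j j.
  by apply: (trig_mul_lead Mtrig) => k jk; rewrite H0 ?ij.
have := unit_trig_diag i Mtrig Mu; rewrite mxE [X in H ^+ X]ij.
by rewrite -mul_krylov_mx E mulf_eq0 negb_or => /andP[].
Qed.

Lemma unitriangular_trig_eq1 {n} {g L : 'M[K]_n} : unitriangular_matrices g ->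
  is_trig_mx L -> L \in unitmx -> is_trig_mx (g *m L) -> g = 1%:M.
Proof.
move=> [g0 g1] Ltrig Lu /is_trig_mxP gL; apply/matrixP => i j; rewrite mxE.
case: (ltngtP i j) => [ij|ji|/val_inj->]; last by rewrite eqxx g1.
  rewrite -val_eqE ltn_eqF//.
  by apply: (trig_mul_row0 (p := i.+1) Ltrig Lu) ij => k; apply: gL.
by rewrite -val_eqE gtn_eqF// g0.
Qed.

End Krylov.

(** * The normal form *)

Section NormalForm.
Context {K : closedFieldType} {n : nat}.

Lemma saturation_H_U (A : 'M[K]_n) :
  saturation (conjugation_action K n) (H_U K n) A <->
  nilpotent_mx A /\ trailing_minors n (krylov_mx A) != 0.
Proof.
split=> [[H HU [g gU <-]]|[Anil /trailing_minors_UL[g [L [gU Ltrig Lu ME]]]]].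
  have [Mtrig Mu] := H_U_krylov HU; split.
    by apply: conjugate_nilpotent => //; case: HU.
  by rewrite krylov_mx_conjugate// UL_trailing_minors.
have gu := unitriangular_unit gU; have gVU := unitriangularV gU.
have LE : krylov_mx (conjugate_mx (invmx g) A) = L.
  by rewrite krylov_mx_conjugate// ME mulKmx.
exists (conjugate_mx (invmx g) A).
  by apply: krylov_H_U; rewrite ?LE//; exact: conjugate_nilpotent.
exists g => //=; rewrite -conjugateM// mulmxV//; exact: conjugate1.
Qed.

Lemma saturation_H_U_open :
  zariski_open_in (points (nilpotent_variety K n))
    (saturation (conjugation_action K n) (H_U K n)).
Proof.
exists [set A | unit -> trailing_minors n (krylov_mx A) = 0]%classic.
  apply: (@zariski_closed_polyfun K n n unit
    (fun _ A => trailing_minors n (krylov_mx A))) => _.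
  apply: polyfun_trailing_minors => i j.
  have eP : polymap (fun A : 'M[K]_n => mxvec A 0) (fun=> first_vec n).
    by move=> k l; apply: polyfun_cst.
  apply: polyfun_ext (polymap_mul (polymap_exp j (@polymap_mxvec K n n)) eP i 0).
  by move=> A; rewrite [in RHS]mxE.
rewrite predeqE => A; split=> [/saturation_H_U[Anil /eqP A0]|[Anil A0]].
  by split=> // /(_ tt).
by apply/saturation_H_U; split=> //; apply/eqP => A1; apply: A0.
Qed.

Lemma H_U_orbit_inj (H H' : 'M[K]_n) : H_U K n H -> H_U K n H' ->
  Defs.orbit (conjugation_action K n) H = Defs.orbit (conjugation_action K n) H' -> H = H'.
Proof.
move=> HU HU' HH'; have [Mtrig Mu] := H_U_krylov HU.
have [Hnil _ _] := HU; have [Hnil' _ _] := HU'.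
have : Defs.orbit (conjugation_action K n) H H'.
  by rewrite HH'; exists 1%:M; [exact: unitriangular1|exact: conjugate1].
move=> [g gU /= gH]; have [Mtrig' _] := H_U_krylov HU'.
rewrite -gH krylov_mx_conjugate// in Mtrig'.
by rewrite -gH (unitriangular_trig_eq1 gU Mtrig Mu Mtrig') conjugate1.
Qed.

End NormalForm.

Theorem corollary4p5 (R : realType) (n : nat) :
  generic_normal_form (conjugation_action R[i] n) (H_U R[i] n).
Proof.
split; first by move=> H [].
  exact: saturation_H_U_open.
by move=> H H' HU HU' HH' /(H_U_orbit_inj _ _ HU HU').
Qed.
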